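(* There is an absolute constant $K_0$ such that for all integers $N\ge1$ and $K\ge K_0$ there is some residue system $C$ consisting of distinct moduli from $(N,KN]$ such that \[ \delta(C)\le\frac1K\exp\left(-\frac{\log K}{3N}\right). \]
   Context: A residue system is a finite set $C$ of ordered pairs of positive integers $(n,r)$, each interpreted as the residue class $r\pmod n$ with modulus $n$; ''distinct moduli'' means that each $n$ occurs in at most one pair of $C$. $R(C)$ is the set of integers not congruent to $r\pmod n$ for any $(n,r)\in C$, and $\delta(C)$ is the asymptotic density of $R(C)$ (which exists, since $R(C)$ is a union of residue classes modulo the least common multiple of the moduli). *)

(* Defs.v *)
From mathcomp Require Import all_boot all_order all_algebra.
From mathcomp Require Import finmap.
From mathcomp Require Import all_classical all_reals all_analysis.
Set Implicit Arguments.
Unset Strict Implicit.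
Unset Printing Implicit Defensive.
Import Order.TTheory GRing.Theory Num.Theory.
Import numFieldNormedType.Exports.
Local Open Scope classical_set_scope.
Local Open Scope ring_scope.

(* A pair p = (n, r) stands for the residue class r (mod n). *)
Definition residue_system (C : {fset nat * nat}) : Prop :=
  forall p, p \in C -> (0 < p.1)%N /\ (0 < p.2)%N.

Definition distinct_moduli (C : {fset nat * nat}) : Prop :=
  {in C &, injective fst}.

Definition uncovered (C : {fset nat * nat}) : set int :=
  [set z | forall p, p \in C -> (z <> p.2%:Z %[mod p.1%:Z])%Z].

(* The index k <= 2M runs over the integers k - M of [-M, M].  Density is a
   relation: has_density A d also asserts that the limit exists. *)
Definition has_density (R : realType) (A : set int) (d : R) : Prop :=
  (fun M : nat =>
     (\sum_(k < M.*2.+1) \1_A (k%:Z - M%:Z)) / (M.*2.+1)%:R : R) @ \oo --> d.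

(* Main.v *)
Require Import Defs.
From mathcomp Require Import all_boot all_order all_algebra.
From mathcomp Require Import finmap.
From mathcomp Require Import all_classical all_reals all_analysis.
From mathcomp Require Import zify ring lra.
Set Implicit Arguments.
Unset Strict Implicit.
Unset Printing Implicit Defensive.
Import Order.TTheory GRing.Theory Num.Theory.
Import numFieldNormedType.Exports.

(* Choose residues greedily for n = N + 1, ..., K N. A residue class mod n that
   is at least average removes a proportion 1 / n of what is left, and
   prod (1 - 1 / n) telescopes to 1 / K. For n > 5 N one does better: the classes
   already chosen for the divisors m of n in a fixed range M just above N cover a
   proportion f(n) of the classes mod n, so that some class removes a proportion
   at least (1 + f(n)) / n, which gains a factor exp (- f(n) / n). Bonferroni
   gives f(n) >= sum_(m | n) 1 / m - sum_(lcm(m, m') | n) 1 / lcm(m, m') with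
   m < m' in M; after division by n and summation over 5 N < n <= K N the gain is
   (S1 - S2) log K + O(1 / N), where S1 = sum 1 / m^2 and
   S2 = sum_(m < m') 1 / lcm(m, m')^2. For M = (N, 2 N], N S1 is close to 1 / 2
   and N S2 <= 1 / 9, which leaves more than the required 1 / 3. *)

(** * Residue classes *)

Lemma sum_modn_classes (P n : nat) (U : pred nat) : (0 < n)%N ->
  (\sum_(y < n) \sum_(x < P) (U x && (x %% n == y)) = \sum_(x < P) U x)%N.
Proof.
move=> n0; rewrite exchange_big /=; apply: eq_bigr => x _.
rewrite (bigD1 (Ordinal (ltn_pmod x n0))) //= eqxx andbT big1 ?addn0 // => y.
by rewrite -val_eqE /= eq_sym => /negbTE ->; rewrite andbF.
Qed.

(** With [u] points in [U] and [e] residues in [E], the [n - e] classes outside [E] share all [u]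
    points, so one has at least [u / (n - e)] of them; and [(n - e) * (n + e) <= n ^ 2]. *)
Lemma dense_class (P n : nat) (U E : pred nat) : (0 < n)%N ->
  (forall x, E (x %% n) -> ~~ U x) ->
  exists2 y, (y < n)%N &
    ((\sum_(x < P) U x) * (n + \sum_(z < n) E z)
       <= (\sum_(x < P) (U x && (x %% n == y))) * n ^ 2)%N.
Proof.
move=> n0 EU; set u := (\sum_(x < P) U x)%N; set e := (\sum_(z < n) E z)%N.
pose c y := (\sum_(x < P) (U x && (x %% n == y)))%N.
have [/existsP[y cy]|] := boolP [exists y : 'I_n, u * (n + e) <= c y * n ^ 2]%N.
  by exists y.
rewrite negb_exists => /forallP cn.
(* Adding [~~ E y] on the left encodes strictness for [y] outside [E]; for [y] in [E] both sides
   vanish. *)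
have cle (y : 'I_n) : (c y * n ^ 2 + (~~ E y) <= ~~ E y * (u * (n + e)))%N.
  have [Ey|nEy] := boolP (E y).
    rewrite mul0n addn0 leqn0 muln_eq0 /c big1 ?eqxx // => x _.
    have [/eqP xy|] := boolP (x %% n == y); last by rewrite andbF.
    by move: (EU x); rewrite xy => /(_ Ey) /negbTE ->.
  by rewrite mul1n addn1 ltnNge; exact: cn.
have sumc : (\sum_(y < n) c y = u)%N by apply: sum_modn_classes.
have sumE : (\sum_(y < n) (~~ E y) + e = n)%N.
  rewrite -big_split /= -[RHS]card_ord -sum1_card.
  by apply: eq_bigr => y _; case: (E y).
have := @leq_sum _ (index_enum (ordinal n)) xpredT _ _ (fun y _ => cle y).
rewrite big_split /= -!big_distrl /= sumc; move: sumE.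
set k := (\sum_(y < n) _)%N => kE; rewrite -[in n ^ 2]kE -[in (n + e)%N]kE => h.
(* Here [k = n - e]. The equation forces [k = 0], hence [e = n > 0] and [u = 0], and then every
   class works. *)
have hk : k + u * e ^ 2 = 0 by nia.
have u0 : u = 0 by move: kE; nia.
by exists 0%N => //; rewrite u0.
Qed.

Lemma sum_class (m q r : nat) : (0 < m)%N ->
  (\sum_(x < q * m) (x == r %[mod m]) = q)%N.
Proof.
move=> m0; elim: q => [|q IH]; first by rewrite mul0n big_ord0.
rewrite mulSnr big_split_ord /= IH -[RHS]addn1; congr addn.
rewrite (bigD1 (Ordinal (ltn_pmod r m0))) //= -modnDmr modn_mod modnDmr modnMDl eqxx.
rewrite big1 // => x; rewrite -val_eqE /= modnMDl.
by rewrite (modn_small (ltn_ord x)) => /negbTE ->.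
Qed.

Lemma eqn_mod_lcm (m n x y : nat) :
  (x == y %[mod m]) && (x == y %[mod n]) = (x == y %[mod lcmn m n]).
Proof.
wlog le : x y / (y <= x)%N.
  move=> H; have [/H//|/ltnW /H] := leqP y x.
  by rewrite !(eq_sym (y %% _)).
by rewrite !eqn_mod_dvd // dvdn_lcm.
Qed.

(** Without a common solution the sum is 0; given a solution [x0], the two congruences amount to the
    class of [x0] modulo the lcm. *)
Lemma sum_class2 (m m' n r r' : nat) : (0 < lcmn m m')%N -> (lcmn m m' %| n)%N ->
  (\sum_(x < n) ((x == r %[mod m]) && (x == r' %[mod m'])) <= n %/ lcmn m m')%N.
Proof.
move=> l0 /dvdnP[q ->]; rewrite mulnK //.
have [/existsP[x0 /andP[/eqP h /eqP h']]|] :=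
  boolP [exists x0 : 'I_(q * lcmn m m'), (x0 == r %[mod m]) && (x0 == r' %[mod m'])].
  rewrite -[leqRHS](@sum_class _ q x0 l0); apply: eq_leq.
  by apply: eq_bigr => x _; rewrite -h -h' eqn_mod_lcm.
rewrite negb_exists => /forallP h; rewrite big1 // => x _.
by rewrite (negbTE (h x)).
Qed.

Local Open Scope classical_set_scope.
Local Open Scope ring_scope.

(** * Sums over pairs and over multiples *)

(** Each pair of positions counts once; on a strictly increasing list these are the pairs
    [x < y]. *)
Fixpoint pair_sum (V : nmodType) (F : nat -> nat -> V) (s : seq nat) : V :=
  if s is x :: t then \sum_(y <- t) F x y + pair_sum F t else 0.

Lemma eq_pair_sum (V : nmodType) (F G : nat -> nat -> V) (s : seq nat) :
  F =2 G -> pair_sum F s = pair_sum G s.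
Proof.
by move=> FG; elim: s => [|x t IH] //=; rewrite IH; congr (_ + _); exact: eq_bigr.
Qed.

Lemma pair_sum_le (R : numDomainType) (F G : nat -> nat -> R) (s : seq nat) :
  sorted ltn s ->
  (forall x y, x \in s -> y \in s -> (x < y)%N -> F x y <= G x y) ->
  pair_sum F s <= pair_sum G s.
Proof.
elim: s => [|x t IH] //= xt FG; apply: lerD.
  rewrite !big_seq; apply: ler_sum => y yt.
  apply: FG; rewrite ?mem_head ?in_cons ?yt ?orbT //.
  by move: xt; rewrite path_sortedE; [case/andP => /allP /(_ _ yt)|exact: ltn_trans].
apply: IH => [|y z yt zt]; first exact: path_sorted xt.
by apply: FG; rewrite in_cons ?yt ?zt orbT.
Qed.

Lemma pair_sum_exchange (V : nmodType) (I : Type) (r : seq I)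
    (F : I -> nat -> nat -> V) (s : seq nat) :
  pair_sum (fun x y => \sum_(i <- r) F i x y) s = \sum_(i <- r) pair_sum (F i) s.
Proof.
elim: s => [|x t IH] /=; first by rewrite big1.
by rewrite IH exchange_big /= -big_split.
Qed.

Lemma pair_sum_ge0 (R : numDomainType) (F : nat -> nat -> R) (s : seq nat) :
  (forall x y, 0 <= F x y) -> 0 <= pair_sum F s.
Proof.
by move=> F0; elim: s => [|x t IH] //=; rewrite addr_ge0 // sumr_ge0.
Qed.

Lemma pair_sum_mull (R : pzRingType) (c : R) (F : nat -> nat -> R) (s : seq nat) :
  pair_sum (fun x y => c * F x y) s = c * pair_sum F s.
Proof.
by elim: s => [|x t IH] /=; rewrite ?mulr0 // IH mulrDr mulr_sumr.
Qed.

Lemma pair_sum_prod (R : comPzRingType) (w : nat -> R) (s : seq nat) :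
  2 * pair_sum (fun x y => w x * w y) s
    = (\sum_(x <- s) w x) ^+ 2 - \sum_(x <- s) w x ^+ 2.
Proof.
elim: s => [|x t IH] /=; first by rewrite !big_nil; ring.
by rewrite mulrDr IH !big_cons -mulr_sumr; ring.
Qed.

(** If [b] holds at the head, the pairs containing the head cancel the sum over the tail, leaving 1
    minus a nonnegative quantity. *)
Lemma bonferroni (R : numDomainType) (b : pred nat) (s : seq nat) :
  \sum_(x <- s) (b x)%:R - pair_sum (fun x y => (b x && b y)%:R) s
    <= (has b s)%:R :> R.
Proof.
elim: s => [|x t IH] /=; first by rewrite big_nil subr0.
rewrite big_cons; case: (b x) => /=; last by rewrite add0r [X in _ - (X + _)]big1 ?add0r.
rewrite opprD [X in X + _]addrC addrACA subrr add0r.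
rewrite gerDl oppr_le0; apply: pair_sum_ge0 => y z; exact: ler0n.
Qed.

Lemma sum_multiples (V : nmodType) (F : nat -> V) (d a b : nat) :
  (0 < d)%N -> (a <= b)%N ->
  \sum_(a.+1 <= i < b.+1 | (d %| i)%N) F i
    = \sum_((a %/ d).+1 <= t < (b %/ d).+1) F (d * t)%N.
Proof.
move=> d0; elim: b => [|b IH]; first by rewrite leqn0 => /eqP ->; rewrite div0n !big_geq.
rewrite leq_eqVlt => /predU1P[->|]; first by rewrite !big_geq.
rewrite ltnS => ab; rewrite big_mkcond big_nat_recr //= -big_mkcond IH // divnS //.
have [db|_] := ifP; last by rewrite add0n addr0.
rewrite add1n [RHS]big_nat_recr ?ltnS ?leq_div2r //=.
by congr (_ + F _); have := divnS b d0; rewrite db add1n => <-; rewrite mulnC divnK.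
Qed.

Lemma sum_telescope_le (R : numDomainType) (f g : nat -> R) (a b : nat) :
  (a <= b)%N -> (forall n, (a <= n < b)%N -> f n.+1 <= g n - g n.+1) ->
  \sum_(a.+1 <= n < b.+1) f n <= g a - g b.
Proof.
move=> ab fg; rewrite big_add1 /= -opprB -telescope_sumr // -sumrN.
by apply: ler_sum_nat => n /fg; rewrite opprB.
Qed.

Lemma sum_telescope_ge (R : numDomainType) (f g : nat -> R) (a b : nat) :
  (a <= b)%N -> (forall n, (a <= n < b)%N -> g n - g n.+1 <= f n.+1) ->
  g a - g b <= \sum_(a.+1 <= n < b.+1) f n.
Proof.
move=> ab fg; rewrite big_add1 /= -opprB -telescope_sumr // -sumrN.
by apply: ler_sum_nat => n /fg; rewrite opprB.
Qed.

(** Cauchy-Schwarz against the constant 1. *)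
Lemma sum_sq_le (R : realFieldType) (w : nat -> R) (s : seq nat) :
  (\sum_(x <- s) w x) ^+ 2 <= (size s)%:R * \sum_(x <- s) w x ^+ 2.
Proof.
elim: s => [|x t IH] /=; first by rewrite !big_nil expr0n mulr0.
rewrite !big_cons -natr1; set P := \sum_(y <- t) w y in IH *.
set Q := \sum_(y <- t) _ in IH *; set k := (size t)%:R in IH *.
have k0 : 0 <= k by rewrite ler0n.
have Q0 : 0 <= Q by rewrite sumr_ge0 // => y _; rewrite sqr_ge0.
(* The cross term comes from [(k * w x - P) ^+ 2 >= 0] and [P ^+ 2 <= k * Q], after division by
   [k]. *)
suff : 2 * w x * P <= k * w x ^+ 2 + Q by nra.
have [k00|kp] := eqVneq k 0.
  have -> : P = 0 by apply/eqP; rewrite -sqrf_eq0 eq_le sqr_ge0 andbT; rewrite k00 mul0r in IH.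
  by rewrite k00; lra.
have {k0}kp : 0 < k by rewrite lt_def kp.
rewrite -(ler_pM2l kp).
have := sqr_ge0 (k * w x - P); nra.
Qed.

(** * The main term S1 - S2 *)

(** [1 / (n + 1)^2] is below [1 / ((n + 1/2) (n + 3/2))], which telescopes. *)
Lemma sum_inv_sq_le (R : realFieldType) (A B : nat) : (A <= B)%N ->
  \sum_(A.+1 <= a < B.+1) (a%:R ^+ 2)^-1
    <= (A%:R + 2^-1)^-1 - (B%:R + 2^-1)^-1 :> R.
Proof.
move=> AB; apply: (@sum_telescope_le _ _ (fun n => (n%:R + 2^-1)^-1)) => // n _.
have n0 : 0 <= n%:R :> R by rewrite ler0n.
rewrite -natr1; set x := n%:R in n0 *.
have -> : (x + 2^-1)^-1 - (x + 1 + 2^-1)^-1 = ((x + 2^-1) * (x + 1 + 2^-1))^-1.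
  by field; rewrite !gt_eqF //; lra.
by rewrite lef_pV2 ?posrE ?mulr_gt0 ?exprn_gt0; nra.
Qed.

(** The shift 11/20 instead of 1/2 reverses the comparison: [(n + 11/20) (n + 31/20) >= (n + 1)^2]
    once [n >= 2]. *)
Lemma sum_inv_sq_ge (R : realFieldType) (A B : nat) : (2 <= A)%N -> (A <= B)%N ->
  (A%:R + 11 / 20)^-1 - (B%:R + 11 / 20)^-1
    <= \sum_(A.+1 <= a < B.+1) (a%:R ^+ 2)^-1 :> R.
Proof.
move=> A2 AB; apply: (@sum_telescope_ge _ _ (fun n => (n%:R + 11 / 20)^-1)) => // n An.
have n0 : 2 <= n%:R :> R by rewrite ler_nat; lia.
rewrite -(natr1 n); set x := n%:R in n0 *.
have -> : (x + 11 / 20)^-1 - (x + 1 + 11 / 20)^-1 = ((x + 11 / 20) * (x + 1 + 11 / 20))^-1.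
  by field; rewrite !gt_eqF //; lra.
by rewrite lef_pV2 ?posrE ?mulr_gt0 ?exprn_gt0; nra.
Qed.

(* By Cauchy-Schwarz, removing the diagonal from p ^+ 2 saves a factor 1 - 1 / (B - A). *)
Lemma sum_inv_sq_off_diagonal (R : realFieldType) (B : nat) :
  (\sum_((B %/ 2).+1 <= a < B.+1) (a%:R ^+ 2)^-1) ^+ 2
      - \sum_((B %/ 2).+1 <= a < B.+1) ((a%:R ^+ 2)^-1) ^+ 2
    <= 4 / (3 * (B%:R + 1) ^+ 2) :> R.
Proof.
set A := (B %/ 2)%N; have AB : (A <= B)%N by rewrite /A; lia.
have := sum_sq_le (fun a => (a%:R ^+ 2)^-1 : R) (index_iota A.+1 B.+1).
have := sum_inv_sq_le R AB.
have : 0 <= \sum_(A.+1 <= a < B.+1) (a%:R ^+ 2)^-1 :> R.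
  by rewrite sumr_ge0 // => a _; rewrite invr_ge0 exprn_ge0 ?ler0n.
rewrite size_iota subSS.
set p := \sum_(_ <= _ < _) _; set q := \sum_(_ <= _ < _) _ => p0 ple pq.
have [k0|k0] := posnP (B - A)%N.
  have A0 : A = 0%N by rewrite /A in k0 *; lia.
  have B0 : B = 0%N by lia.
  rewrite {}/p {}/q in p0 ple pq *; rewrite A0 B0 !big_geq // expr0n /= subr0.
  by rewrite divr_ge0 ?mulr_ge0 ?sqr_ge0.
set a : R := A%:R in ple.
have a0 : 0 <= a by rewrite ler0n.
(* [k] will be the number of terms and [k / D] the telescoped bound on [p]; [q >= p ^+ 2 / k] leaves
   [(1 - 1 / k) p ^+ 2]. *)
have off (k D : R) : 1 <= k -> 0 < D -> p ^+ 2 <= k * q -> p <= k / D ->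
    p ^+ 2 - q <= k * (k - 1) / D ^+ 2.
  move=> k1 D0 kq pD; have kp : 0 < k by lra.
  have pD2 : p ^+ 2 <= (k / D) ^+ 2 by rewrite lerXn2r ?nnegrE // divr_ge0 ?ltW.
  have -> : k * (k - 1) / D ^+ 2 = (k - 1) / k * (k / D) ^+ 2.
    by field; rewrite !gt_eqF.
  apply: (@le_trans _ _ ((k - 1) / k * p ^+ 2)); last first.
    by rewrite ler_wpM2l // divr_ge0 //; lra.
  have -> : (k - 1) / k * p ^+ 2 = p ^+ 2 - k^-1 * p ^+ 2 by field; rewrite gt_eqF.
  by rewrite lerB // ler_pdivrMl.
(* By parity of [B] there are [a] or [a + 1] terms; [D] is [(A + 1/2) (B + 1/2)], the denominator of
   the telescoped difference. *)
have [e|e] : B = A.*2 \/ B = A.*2.+1 by rewrite /A; lia.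
  have k : (B - A)%:R = a :> R by congr _%:R; lia.
  have b : B%:R = 2 * a :> R by rewrite e -muln2 natrM mulrC.
  have {}a0 : 1 <= a by rewrite -k ler1n.
  rewrite k b in ple pq *.
  apply: (le_trans (off _ ((a + 2^-1) * (2 * a + 2^-1)) a0 _ pq _)).
  - by rewrite mulr_gt0; lra.
  - by apply: (le_trans ple); rewrite le_eqVlt; apply/predU1P; left; field; rewrite !gt_eqF; lra.
  rewrite ler_pdivrMr ?exprn_gt0 ?mulr_gt0; [|lra..].
  rewrite mulrAC ler_pdivlMr ?mulr_gt0 ?exprn_gt0; [|lra..].
  have -> : 4 * ((a + 2^-1) * (2 * a + 2^-1)) ^+ 2 = (2 * a + 1) ^+ 2 * (2 * a + 2^-1) ^+ 2 by field.
  by rewrite mulrCA mulrA mulrC ler_wpM2l ?sqr_ge0 //; nra.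
have k : (B - A)%:R = a + 1 :> R by rewrite natr1; congr _%:R; lia.
have b : B%:R = 2 * a + 1 :> R by rewrite e -natr1 -muln2 natrM mulrC.
rewrite k b in ple pq *.
have a1 : 1 <= a + 1 by lra.
apply: (le_trans (off _ ((a + 2^-1) * (2 * a + 1 + 2^-1)) a1 _ pq _)).
- by rewrite mulr_gt0; lra.
- by apply: (le_trans ple); rewrite le_eqVlt; apply/predU1P; left; field; rewrite !gt_eqF; lra.
rewrite ler_pdivrMr ?exprn_gt0 ?mulr_gt0; [|lra..].
rewrite mulrAC ler_pdivlMr ?mulr_gt0 ?exprn_gt0; [|lra..].
have a2 : 0 <= a * a by rewrite mulr_ge0.
have a3 : 0 <= a * a * a by rewrite mulr_ge0.
have a4 : 0 <= a * a * a * a by rewrite mulr_ge0.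
lra.
Qed.

(** Write [m = a g], [m' = b g] with [a < b]. If [a = 1], then [m' >= 2 m > 2 N]; so [b >= 3] and
    [3 g <= m']. *)
Lemma gcdn_le_two_thirds (N m m' : nat) :
  (N < m)%N -> (m < m')%N -> (m' <= 2 * N)%N -> (gcdn m m' <= 2 * N %/ 3)%N.
Proof.
move=> Nm mm' m'N; rewrite leq_divRL //.
have /dvdnP[a ea] := dvdn_gcdl m m'; have /dvdnP[b eb] := dvdn_gcdr m m'.
move: ea eb; set g := gcdn m m' => ea eb.
have ab : (a < b)%N by rewrite -(@ltn_pmul2r g) -?ea -?eb // lt0n; apply/eqP => g0; lia.
have a2 : (1 < a)%N.
  rewrite ltnNge; apply/negP => a1.
  have : (2 * a * g <= b * g)%N by rewrite leq_mul2r; apply/orP; right; lia.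
  rewrite -mulnA -ea -eb; lia.
apply: leq_trans m'N; rewrite eb mulnC leq_mul2r; apply/orP; right; lia.
Qed.

(** Since [lcm = m m' / gcd], the left side is the term [d = gcd] of the sum. For each fixed [d] the
    summand is a product, which decouples [m] from [m']. *)
Lemma inv_lcm_sq_le (R : realFieldType) (N m m' : nat) :
  (N < m)%N -> (m < m')%N -> (m' <= 2 * N)%N ->
  ((lcmn m m')%:R ^+ 2)^-1 <=
    \sum_(1 <= d < (2 * N %/ 3).+1) d%:R ^+ 2 *
      ((d %| m)%N%:R / m%:R ^+ 2 * ((d %| m')%N%:R / m'%:R ^+ 2)) :> R.
Proof.
move=> Nm mm' m'N; have g0 : (0 < gcdn m m')%N by rewrite gcdn_gt0; lia.
have gD := gcdn_le_two_thirds Nm mm' m'N.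
rewrite (bigD1_seq (gcdn m m')) ?iota_uniq //=; last by rewrite mem_index_iota g0.
rewrite dvdn_gcdl dvdn_gcdr !div1r ler_wpDr //.
  apply: sumr_ge0 => d _.
  by rewrite !mulr_ge0 ?invr_ge0 ?sqr_ge0 ?ler0n.
rewrite -invfM -exprMn -natrM -(muln_lcm_gcd m m') natrM exprMn.
rewrite le_eqVlt; apply/predU1P; left; field.
by rewrite !pnatr_eq0 -!lt0n g0 lcmn_gt0; lia.
Qed.

(** Taking [phi] to be the identity or the square covers both sums in [pair_sum_prod] by one
    substitution [m = d t]. *)
Lemma sum_dvdn_weight (R : realFieldType) (phi : R -> R) (N d : nat) :
  (0 < d)%N -> phi 0 = 0 ->
  \sum_(m <- index_iota N.+1 (2 * N).+1) phi ((d %| m)%N%:R / m%:R ^+ 2)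
    = \sum_((N %/ d).+1 <= t < (2 * N %/ d).+1) phi (d%:R ^- 2 * t%:R ^- 2).
Proof.
move=> d0 phi0; under [RHS]eq_bigr do rewrite -invfM -exprMn -natrM.
rewrite -(sum_multiples (fun n => phi (n%:R ^- 2))) //; last lia.
rewrite [RHS]big_mkcond; apply: eq_bigr => m _.
by case: (d %| m)%N; rewrite ?mul1r // mul0r.
Qed.

(* With gcd(m, m')^2 <= sum_(d | gcd) d^2, each d contributes at most
   1 / (6 N^2), and only d <= 2 N / 3 divides two elements of (N, 2 N]. *)
Lemma sum_inv_lcm_sq (R : realFieldType) (N : nat) : (0 < N)%N ->
  pair_sum (fun m m' => ((lcmn m m')%:R ^+ 2)^-1) (index_iota N.+1 (2 * N).+1)
    <= (9 * N%:R)^-1 :> R.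
Proof.
move=> N0; have Np : 0 < N%:R :> R by rewrite ltr0n.
pose w d m : R := (d %| m)%N%:R / m%:R ^+ 2.
apply: (@le_trans _ _ (\sum_(1 <= d < (2 * N %/ 3).+1)
    d%:R ^+ 2 * pair_sum (fun m m' => w d m * w d m') (index_iota N.+1 (2 * N).+1))).
  under eq_bigr do rewrite -pair_sum_mull.
  rewrite -pair_sum_exchange; apply: pair_sum_le; first exact: iota_ltn_sorted.
  move=> m m'; rewrite !mem_index_iota => /andP[Nm _] /andP[_ m'N] mm'.
  exact: inv_lcm_sq_le.
apply: (@le_trans _ _ (\sum_(1 <= d < (2 * N %/ 3).+1) (6 * N%:R ^+ 2)^-1)); last first.
  rewrite sumr_const_nat subn1 /= -[_ *+ _]mulr_natl ler_pdivrMr ?mulr_gt0 ?exprn_gt0 //.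
  have -> : (9 * N%:R)^-1 * (6 * N%:R ^+ 2) = 2 * N%:R / 3 :> R by field; rewrite gt_eqF.
  rewrite ler_pdivlMr // -!natrM ler_nat; lia.
apply: ler_sum_nat => d /andP[d0 _]; have dp : 0 < d%:R :> R by rewrite ltr0n.
have T := pair_sum_prod (w d) (index_iota N.+1 (2 * N).+1).
have P1 : \sum_(m <- index_iota N.+1 (2 * N).+1) w d m
    = d%:R ^- 2 * \sum_((N %/ d).+1 <= t < (2 * N %/ d).+1) t%:R ^- 2.
  by rewrite mulr_sumr (sum_dvdn_weight N (phi := id)).
have Q1 : \sum_(m <- index_iota N.+1 (2 * N).+1) w d m ^+ 2
    = d%:R ^- 2 ^+ 2 * \sum_((N %/ d).+1 <= t < (2 * N %/ d).+1) t%:R ^- 2 ^+ 2.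
  rewrite mulr_sumr (sum_dvdn_weight N (phi := fun x => x ^+ 2)) ?expr0n //.
  by apply: eq_bigr => t _; rewrite exprMn.
have := sum_inv_sq_off_diagonal R (2 * N %/ d).
(* This puts the range of [t] in the form [(B / 2, B]] with [B] the floor of [2 N / d]. *)
have -> : (2 * N %/ d %/ 2 = N %/ d)%N by rewrite divnAC mulKn.
rewrite P1 {}Q1 in T; move: T.
set p := \sum_(_ <= _ < _) _; set q := \sum_(_ <= _ < _) _.
set S := pair_sum _ _; set B := (2 * N %/ d)%N => T off.
have dB : 2 * N%:R <= d%:R * (B%:R + 1) :> R.
  by rewrite natr1 -!natrM ler_nat [leqRHS]mulnC ltnW // ltn_ceil.
have -> : d%:R ^+ 2 * S = 2^-1 * d%:R ^- 2 * (p ^+ 2 - q).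
  have -> : S = 2^-1 * (2 * S) by field.
  by rewrite T; field; rewrite gt_eqF.
have B0 : 0 < B%:R + 1 :> R by rewrite ltr_wpDl ?ler0n.
apply: le_trans (ler_wpM2l _ off) _; first by rewrite mulr_ge0 ?invr_ge0 ?sqr_ge0.
have -> : 2^-1 * d%:R ^- 2 * (4 / (3 * (B%:R + 1) ^+ 2))
    = (3 / 2 * (d%:R * (B%:R + 1)) ^+ 2)^-1 :> R.
  by field; rewrite !gt_eqF.
rewrite lef_pV2 ?posrE ?mulr_gt0 ?exprn_gt0 ?mulr_gt0 ?invr_gt0 //.
have : (2 * N%:R) ^+ 2 <= (d%:R * (B%:R + 1)) ^+ 2 :> R.
  by rewrite lerXn2r // nnegrE mulr_ge0 // ltW.
lra.
Qed.

(* The interval (N, 2 N] is too short when N is 1 or 2, where (N, N + 4] works. *)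
Lemma base_gain (R : realFieldType) (N : nat) : (0 < N)%N ->
  exists2 E, (N <= E <= 5 * N)%N &
    let M := index_iota N.+1 E.+1 in
    1 / 3 + 1 / 200 <= N%:R * (\sum_(m <- M) (m%:R ^+ 2)^-1
        - pair_sum (fun m m' => ((lcmn m m')%:R ^+ 2)^-1) M) :> R.
Proof.
(* The general estimate [n^2 / ((n + 11/20) (2 n + 11/20)) - 1/9] reaches 1/3 + 1/200 at 8 but not
   at 7; smaller [N] are computed exactly. *)
move=> N0; have [N8|N8] := leqP 8 N.
  exists (2 * N)%N; first lia.
  move=> M; have := sum_inv_lcm_sq R N0; rewrite -/M.
  have := @sum_inv_sq_ge R N (2 * N) _ _; rewrite -/M => /(_ ltac:(lia) ltac:(lia)).
  set S1 := \sum_(m <- M) _; set S2 := pair_sum _ _ => h1 h2.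
  have n8 : 8 <= N%:R :> R by rewrite ler_nat.
  rewrite natrM in h1; set n := N%:R in n8 h1 h2 *.
  have n0 : 0 < n by lra.
  have : n * ((n + 11 / 20)^-1 - (2 * n + 11 / 20)^-1 - (9 * n)^-1) <= n * (S1 - S2).
    by rewrite ler_wpM2l ?(ltW n0) //; lra.
  apply: le_trans.
  have -> : n * ((n + 11 / 20)^-1 - (2 * n + 11 / 20)^-1 - (9 * n)^-1)
     = n ^+ 2 / ((n + 11 / 20) * (2 * n + 11 / 20)) - 1 / 9.
    by field; rewrite !gt_eqF //; lra.
  rewrite -lerBlDr opprK ler_pdivlMr; last by rewrite mulr_gt0; lra.
  nra.
exists (if (N <= 2)%N then N + 4 else 2 * N)%N; first by case: (leqP N 2) => ?; lia.
case: N N0 N8 => [|[|[|[|[|[|[|[|N]]]]]]]] // _ _.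
all: rewrite /index_iota /= !big_cons !big_nil.
all: repeat match goal with |- context[lcmn ?a ?b] =>
  let v := eval vm_compute in (lcmn a b) in change (lcmn a b) with v end.
all: lra.
Qed.

(** * Logarithmic sums over multiples *)

Lemma ln_le_sub1 (R : realType) (x : R) : 0 < x -> ln x <= x - 1.
Proof.
move=> x0; rewrite -[leLHS]addr0 -(subrr 1) addrA lerB //.
by have := expR_ge1Dx (ln x); rewrite lnK ?posrE // addrC.
Qed.

Lemma harmonic_block_ge (R : realType) (a b : nat) : (a <= b)%N ->
  ln b.+1%:R - ln a.+1%:R <= \sum_(a.+1 <= t < b.+1) t%:R^-1 :> R.
Proof.
move=> ab; rewrite addrC -[X in _ + X]opprK.
apply: (@sum_telescope_ge _ _ (fun n => - ln n.+1%:R)) => // n _; rewrite opprK addrC.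
rewrite -ln_div ?posrE ?ltr0n //; apply: le_trans (ln_le_sub1 _) _.
  by rewrite divr_gt0 ?ltr0n.
by rewrite -[n.+2%:R]natr1 mulrDl divff ?pnatr_eq0 // addrAC subrr add0r div1r.
Qed.

Lemma harmonic_le (R : realType) (b : nat) : (0 < b)%N ->
  \sum_(1 <= t < b.+1) t%:R^-1 <= 1 + ln b%:R :> R.
Proof.
move=> b0; rewrite big_ltn // invr1 lerD2l.
have -> : ln b%:R = - ln 1%:R - - ln b%:R :> R by rewrite ln1 oppr0 add0r opprK.
apply: (@sum_telescope_le _ _ (fun n => - ln n%:R)) => // n /andP[n0 _]; rewrite opprK addrC.
rewrite -[X in _ <= X]opprK opprB -ln_div ?posrE ?ltr0n // lerNr.
apply: le_trans (ln_le_sub1 _) _; first by rewrite divr_gt0 ?ltr0n.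
rewrite -[n%:R](addrK 1) natr1 mulrBl divff ?pnatr_eq0 //.
by rewrite addrAC subrr add0r mul1r.
Qed.

Lemma sum_inv_multiples (R : realType) (d a b : nat) : (0 < d)%N -> (a <= b)%N ->
  \sum_(a.+1 <= n < b.+1) (d %| n)%N%:R / n%:R
    = d%:R^-1 * \sum_((a %/ d).+1 <= t < (b %/ d).+1) t%:R^-1 :> R.
Proof.
move=> d0 ab; rewrite mulr_sumr; under [RHS]eq_bigr do rewrite -invfM -natrM.
rewrite -(sum_multiples (fun n => n%:R^-1)) // [RHS]big_mkcond.
by apply: eq_bigr => n _; case: (d %| n)%N; rewrite ?mul1r ?mul0r.
Qed.

(** With [n = d t] and [d >= N], [t] stays at most [K], so a harmonic sum up to [K] suffices. *)
Lemma sum_inv_multiples_le (R : realType) (N K d : nat) :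
  (0 < N)%N -> (N <= d)%N -> (5 <= K)%N ->
  \sum_((5 * N).+1 <= n < (K * N).+1) (d %| n)%N%:R / n%:R
    <= d%:R^-1 * (ln K%:R + 1) :> R.
Proof.
move=> N0 Nd K5; have d0 : (0 < d)%N by lia.
rewrite sum_inv_multiples ?leq_mul2r ?K5 ?orbT // ler_wpM2l ?invr_ge0 //.
have lnK : 0 <= ln K%:R :> R by rewrite ln_ge0 // ler1n; lia.
have [T0|T0] := posnP (K * N %/ d)%N.
  by rewrite T0 big_geq ?addr_ge0 // ltnS.
have TK : (K * N %/ d <= K)%N.
  by rewrite -[leqRHS](mulnK K d0) leq_div2r // leq_mul2l Nd orbT.
apply: (@le_trans _ _ (\sum_(1 <= t < (K * N %/ d).+1) t%:R^-1)).
  rewrite [leRHS](big_cat_nat (n := (5 * N %/ d).+1)) //=.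
    by rewrite lerDr sumr_ge0.
  by rewrite ltnS leq_div2r // leq_mul2r K5 orbT.
apply: le_trans (harmonic_le R T0) _.
by rewrite addrC lerD2r ler_ln ?posrE ?ltr0n ?ler_nat //; lia.
Qed.

(** With [n = d t], [N < d] makes the first [t] at most 5 and [d <= 5 N] makes the last one plus 1
    at least [K / 5]: each end costs at most [ln 5]. *)
Lemma sum_inv_multiples_ge (R : realType) (N K d : nat) :
  (0 < N)%N -> (N < d)%N -> (d <= 5 * N)%N -> (5 <= K)%N ->
  d%:R^-1 * (ln K%:R - 2 * ln 5)
    <= \sum_((5 * N).+1 <= n < (K * N).+1) (d %| n)%N%:R / n%:R :> R.
Proof.
move=> N0 Nd dN K5; have d0 : (0 < d)%N by lia.
rewrite sum_inv_multiples ?leq_mul2r ?K5 ?orbT // ler_wpM2l ?invr_ge0 //.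
apply: le_trans (harmonic_block_ge R _); last by rewrite leq_div2r // leq_mul2r K5 orbT.
have A5 : ((5 * N %/ d).+1 <= 5)%N by rewrite ltn_divLR //; lia.
have lA : ln (5 * N %/ d).+1%:R <= ln 5 :> R.
  by rewrite ler_ln ?posrE ?ltr0n // ler_nat.
suff : ln K%:R - ln 5 <= ln (K * N %/ d).+1%:R :> R by lra.
rewrite -ln_div ?posrE ?ltr0n //; last lia.
rewrite ler_ln ?posrE ?divr_gt0 ?ltr0n //; last lia.
rewrite ler_pdivrMr ?ltr0n // -natrM ler_nat.
have : (K * N < (K * N %/ d).+1 * d)%N by rewrite ltn_ceil.
move: (K * N %/ d).+1 => T.
nia.
Qed.

(** * Greedy choice of residues *)

(** The Bonferroni lower bound for [f(n)]; it does not depend on the residues chosen. *)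
Definition covered_part (R : realType) (M : seq nat) (n : nat) : R :=
  \sum_(m <- M) (m %| n)%N%:R / m%:R
    - pair_sum (fun m m' => (lcmn m m' %| n)%N%:R / (lcmn m m')%:R) M.

(** Bonferroni summed over [z < n]: for [m] dividing [n] a class has exactly [n / m] elements, and
    two classes share at most [n / lcm]. *)
Lemma covered_part_le (R : realType) (M : seq nat) (r : nat -> nat) (n : nat) :
  sorted ltn M -> {in M, forall m, 0 < m}%N ->
  n%:R * covered_part R M n
    <= (\sum_(z < n) has (fun m => (m %| n) && (z == r m %[mod m])) M)%N%:R.
Proof.
move=> Ms M0; pose b z m := (m %| n)%N && (z == r m %[mod m]).
rewrite natr_sum; apply: (@le_trans _ _ (\sum_(z < n)
    (\sum_(m <- M) (b z m)%:R - pair_sum (fun m m' => (b z m && b z m')%:R) M))); last first.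
  by apply: ler_sum => z _; exact: bonferroni.
rewrite sumrB exchange_big -pair_sum_exchange mulrBr; apply: lerB.
  rewrite mulr_sumr !big_seq; apply: ler_sum => m /M0 m0.
  rewrite -natr_sum /b; have [/dvdnP[q ->]|_] := boolP (m %| n)%N.
    rewrite (sum_class q (r m) m0) natrM mul1r mulfK // pnatr_eq0; lia.
  by rewrite mul0r mulr0 ler0n.
rewrite -pair_sum_mull; apply: pair_sum_le => // m m' /M0 m0 /M0 m'0 _.
rewrite -natr_sum /b dvdn_lcm.
have [mn|_] /= := boolP (m %| n)%N; last by rewrite big1 // mul0r mulr0.
have [m'n|_] /= := boolP (m' %| n)%N; last first.
  by rewrite big1 ?mul0r ?mulr0 // => z _; rewrite andbF.
have l0 : (0 < lcmn m m')%N by rewrite lcmn_gt0 m0 m'0.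
have ln : (lcmn m m' %| n)%N by rewrite dvdn_lcm mn m'n.
rewrite mul1r ler_pdivlMr ?ltr0n // -natrM ler_nat -leq_divRL //.
exact: sum_class2.
Qed.

Definition avoids (N B : nat) (r : nat -> nat) (x : nat) : bool :=
  all (fun n => x != r n %[mod n]) (index_iota N.+1 B.+1).

Lemma avoidsS (N B : nat) (r : nat -> nat) (x : nat) : (N <= B)%N ->
  avoids N B.+1 r x = avoids N B r x && (x != r B.+1 %[mod B.+1]).
Proof.
move=> NB; rewrite /avoids /index_iota !subSS subSn // -(addn1 (B - N)) iotaD all_cat /= andbT.
by rewrite addSn subnKC.
Qed.

Lemma eq_avoids (N B : nat) (r r' : nat -> nat) (x : nat) :
  (forall n, (n <= B)%N -> r n = r' n) -> avoids N B r x = avoids N B r' x.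
Proof.
move=> rr; apply: eq_in_all => n; rewrite mem_index_iota => /andP[_ nB].
by rewrite rr.
Qed.

(** [(1 - 1/n) (1 - f/n)] exceeds the left side by [f / n^2], and [1 - f/n <= expR (- (f/n))]. *)
Lemma greedy_factor (R : realType) (n : nat) (f t : R) : (1 < n)%N -> 0 <= f -> t <= f / n%:R ->
  1 - (1 + f) / n%:R <= (1 - n%:R^-1) * expR (- t).
Proof.
move=> n1 f0 tf; have n0 : 0 < n%:R :> R by rewrite ltr0n; lia.
have i0 : 0 < n%:R^-1 :> R by rewrite invr_gt0.
have i1 : n%:R^-1 <= 1 :> R by rewrite invf_le1 // ler1n; lia.
apply: (@le_trans _ _ ((1 - n%:R^-1) * (1 - f / n%:R))).
  rewrite mulrDl mul1r; set i := _^-1 in i0 i1 *.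
  have : 0 <= i * (f * i) by rewrite !mulr_ge0 // ltW.
  lra.
rewrite ler_wpM2l ?subr_ge0 //.
apply: le_trans (expR_ge1Dx (- (f / n%:R))) _.
by rewrite ler_expR lerN2.
Qed.

(** Induction on [B], with [dense_class] supplying each new residue. Only points below [P] are
    counted, so no periodicity is involved yet. *)
Lemma greedy_residues (R : realType) (P N E B : nat) (M : seq nat) :
  (0 < N)%N -> (N <= B)%N ->
  sorted ltn M -> {in M, forall m, N < m <= E}%N ->
  exists r : nat -> nat,
    (\sum_(x < P) avoids N B r x)%N%:R
      <= P%:R * \prod_(N.+1 <= n < B.+1) (1 - n%:R^-1)
         * expR (- \sum_(N.+1 <= n < B.+1 | (E < n)%N) covered_part R M n / n%:R) :> R.
Proof.
move=> N0 NB Ms MN; elim: B NB => [|B IH]; first lia.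
rewrite leq_eqVlt => /predU1P[->|].
  exists id; rewrite !big_geq // oppr0 expR0 !mulr1 ler_nat.
  rewrite -[leqRHS]card_ord -sum1_card; apply: leq_sum => x _; exact: leq_b1.
rewrite ltnS => NB; have [r hr] := IH NB; set n := B.+1.
(* [C] marks the residues mod [n] covered through divisors in [M]; it is empty for [n <= E], where
   some moduli of [M] may still lack a residue. *)
pose C z := (E < n)%N && has (fun m => (m %| n)%N && (z == r m %[mod m])) M.
have CU x : C (x %% n)%N -> ~~ avoids N B r x.
  case/andP => En /hasP[m mM /andP[mn xm]]; apply/allPn; exists m.
    by have := MN m mM; rewrite mem_index_iota /n in En *; lia.
  by rewrite negbK -(modn_dvdm x mn).
have [y yn hy] := @dense_class P n _ C (ltn0Sn B) CU.
exists (fun k => if k == n then y else r k).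
have n1 : (1 < n)%N by rewrite /n; lia.
have nR : 0 < n%:R :> R by rewrite ltr0n.
set u := (\sum_(x < P) avoids N B r x)%N in hr hy.
set c := (\sum_(x < P) _)%N in hy; set e := (\sum_(z < n) C z)%N in hy.
have -> : (\sum_(x < P) avoids N n (fun k => if k == n then y else r k) x)%N%:R
    = u%:R - c%:R :> R.
  apply/eqP; rewrite eq_sym subr_eq -natrD eqr_nat -big_split /=; apply/eqP/eq_bigr => x _.
  rewrite avoidsS // eqxx (modn_small yn).
  rewrite (@eq_avoids _ _ (fun k => if k == n then y else r k) r); last first.
    by move=> k kB; case: eqP => // kn; move: kB; rewrite kn ltnn.
  by case: (avoids _ _ _ _); case: (_ == _).
have c_ge : u%:R * ((1 + e%:R / n%:R) / n%:R) <= c%:R :> R.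
  rewrite mulrA ler_pdivrMr // -(ler_pM2r nR).
  have -> : u%:R * (1 + e%:R / n%:R) * n%:R = u%:R * (n%:R + e%:R) :> R.
    by field; rewrite gt_eqF.
  by rewrite -natrD -!natrM ler_nat -mulnA.
set t := if (E < n)%N then covered_part R M n / n%:R else 0.
have tf : t <= e%:R / n%:R / n%:R.
  rewrite /t /e /C; case: ifP => [_|_]; last by rewrite !divr_ge0.
  rewrite ler_wpM2r ?invr_ge0 // ler_pdivlMr // mulrC; apply: covered_part_le => //.
  by move=> m /MN; lia.
have f0 : 0 <= e%:R / n%:R :> R by rewrite divr_ge0.
have -> : \sum_(N.+1 <= k < n.+1 | (E < k)%N) covered_part R M k / k%:R
    = \sum_(N.+1 <= k < n | (E < k)%N) covered_part R M k / k%:R + t.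
  by rewrite big_mkcond big_nat_recr //= -big_mkcond.
rewrite big_nat_recr //= opprD expRD.
apply: (@le_trans _ _ (u%:R * (1 - (1 + e%:R / n%:R) / n%:R))); first by rewrite mulrBr mulr1 lerB.
apply: le_trans (ler_wpM2l _ (greedy_factor n1 f0 tf)) _; first by rewrite ler0n.
apply: le_trans (ler_wpM2r _ hr) _.
  rewrite mulr_ge0 ?expR_ge0 // subr_ge0 invf_le1 // ler1n; lia.
by rewrite le_eqVlt; apply/predU1P; left; ring.
Qed.

(** After exchanging sums, [m] contributes [1 / m] times the sum of [1 / n] over its multiples,
    bounded below; pairs contribute likewise through their lcm, bounded above, for which lcm at
    least [N] is enough. *)
Lemma covered_part_gain (R : realType) (N K : nat) (M : seq nat) :
  (0 < N)%N -> (5 <= K)%N -> sorted ltn M -> {in M, forall m, N < m <= 5 * N}%N ->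
  (\sum_(m <- M) (m%:R ^+ 2)^-1) * (ln K%:R - 2 * ln 5)
      - pair_sum (fun m m' => ((lcmn m m')%:R ^+ 2)^-1) M * (ln K%:R + 1)
    <= \sum_((5 * N).+1 <= n < (K * N).+1) covered_part R M n / n%:R.
Proof.
move=> N0 K5 Ms MN; set I := index_iota (5 * N).+1 (K * N).+1.
have -> : \sum_(n <- I) covered_part R M n / n%:R
    = \sum_(m <- M) m%:R^-1 * \sum_(n <- I) (m %| n)%N%:R / n%:R
      - pair_sum (fun m m' => (lcmn m m')%:R^-1
          * \sum_(n <- I) (lcmn m m' %| n)%N%:R / n%:R) M.
  under [X in X - _]eq_bigr do rewrite mulr_sumr.
  rewrite exchange_big /=.
  under eq_pair_sum do rewrite mulr_sumr.
  rewrite pair_sum_exchange -sumrB; apply: eq_bigr => n _.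
  rewrite /covered_part mulrBl mulr_suml; congr (_ - _).
    by apply: eq_bigr => m _; rewrite mulrCA mulrA.
  rewrite mulrC -pair_sum_mull; apply: eq_pair_sum => m m'.
  by rewrite mulrC mulrCA mulrA.
apply: lerB.
  rewrite mulr_suml !big_seq; apply: ler_sum => m.
  move=> /MN /andP[Nm mE].
  rewrite expr2 invfM -mulrA ler_wpM2l ?invr_ge0 //.
  exact: sum_inv_multiples_ge.
rewrite [leRHS]mulrC -pair_sum_mull; apply: pair_sum_le => // m m' /MN /andP[Nm _] /MN /andP[Nm' _] _.
rewrite [leRHS]mulrC expr2 invfM -mulrA ler_wpM2l ?invr_ge0 //.
apply: sum_inv_multiples_le => //.
by rewrite (leq_trans (ltnW Nm)) // dvdn_leq ?dvdn_lcml // lcmn_gt0; lia.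
Qed.

Lemma prod_one_sub_inv (R : numFieldType) (a b : nat) : (0 < a)%N -> (a <= b)%N ->
  \prod_(a.+1 <= n < b.+1) (1 - n%:R^-1) = a%:R / b%:R :> R.
Proof.
move=> a0; elim: b => [|b IH]; first by rewrite leqNgt a0.
rewrite leq_eqVlt => /predU1P[<-|].
  by rewrite big_geq // divff // pnatr_eq0; lia.
rewrite ltnS => ab; rewrite big_nat_recr //= IH //.
have b0 : b%:R != 0 :> R by rewrite pnatr_eq0; lia.
have b1 : b%:R + 1 != 0 :> R by rewrite natr1 pnatr_eq0.
by rewrite -(natr1 b); field; rewrite b1.
Qed.

(** * Averages of periodic sequences *)

Lemma sum_period (R : zmodType) (G : nat -> R) (P s : nat) :
  (forall n, G (n + P)%N = G n) -> \sum_(k < P) G (s + k)%N = \sum_(k < P) G k.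
Proof.
move=> GP; elim: s => [|s <-]; first by [].
apply: (addrI (G s)); rewrite [RHS]addrC -{2}(GP s).
rewrite -(big_ord_recr P (fun k => G (s + k)%N)) big_ord_recl addn0; congr (_ + _).
by apply: eq_bigr => k _; rewrite /= addSnnS.
Qed.

(** Full periods match exactly; the incomplete one and its expected value both lie in
    [[0, n %% P]]. *)
Lemma sum_periodic_approx (R : realFieldType) (G : nat -> R) (P s n : nat) :
  (0 < P)%N -> (forall k, G (k + P)%N = G k) -> (forall k, 0 <= G k <= 1) ->
  `|\sum_(k < n) G (s + k)%N - n%:R * ((\sum_(k < P) G k) / P%:R)| <= P%:R.
Proof.
move=> P0 GP G01; set u := \sum_(k < P) G k.
have PR : 0 < P%:R :> R by rewrite ltr0n.
have bnd t m : 0 <= \sum_(k < m) G (t + k)%N <= m%:R.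
  rewrite sumr_ge0 => [|k _]; last by case/andP: (G01 (t + k)%N).
  rewrite -[X in _ <= X%:R]card_ord -sum1_card natr_sum.
  by apply: ler_sum => k _; case/andP: (G01 (t + k)%N).
have full q : \sum_(k < q * P) G (s + k)%N = q%:R * u.
  elim: q => [|q IH]; first by rewrite mul0n big_ord0 mul0r.
  rewrite mulSnr big_split_ord /= IH -natr1 mulrDl mul1r; congr (_ + _).
  by under eq_bigr do rewrite addnA; exact: sum_period.
have /andP[u0 uP] : 0 <= u <= P%:R := bnd 0%N P.
have -> : \sum_(k < n) G (s + k)%N
    = (n %/ P)%N%:R * u + \sum_(k < n %% P) G (s + (n %/ P * P) + k)%N.
  have split q r : \sum_(k < q * P + r) G (s + k)%N
      = q%:R * u + \sum_(k < r) G (s + q * P + k)%N.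
    rewrite big_split_ord /= full; congr (_ + _).
    by apply: eq_bigr => k _; rewrite addnA.
  by rewrite -split -divn_eq.
have -> : n%:R * (u / P%:R) = (n %/ P)%N%:R * u + (n %% P)%N%:R * (u / P%:R).
  by rewrite {1}(divn_eq n P) natrD natrM mulrDl; congr (_ + _); field; rewrite gt_eqF.
have /andP[] := bnd (s + n %/ P * P)%N (n %% P)%N.
set v := \sum_(_ < _) _; set r := (n %% P)%N%:R => v0 vr.
have rP : r <= P%:R :> R by rewrite ler_nat ltnW // ltn_pmod.
have d0 : 0 <= u / P%:R by rewrite divr_ge0 // ltW.
have d1 : u / P%:R <= 1 by rewrite ler_pdivrMr // mul1r.
have r0 : 0 <= r by rewrite ler0n.
have : 0 <= r * (u / P%:R) <= r by rewrite mulr_ge0 //= ler_piMr.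
set w := r * _ => /andP[w0 wr].
rewrite opprD addrACA subrr add0r ler_norml; apply/andP; split; lra.
Qed.

(** * Density *)

Lemma has_density_periodic (R : realType) (A : set int) (P : nat) : (0 < P)%N ->
  (forall z, \1_A (z + P%:Z) = \1_A z :> R) ->
  has_density A ((\sum_(k < P) \1_A k%:Z) / P%:R : R).
Proof.
move=> P0 AP; rewrite /has_density; set d := _ / _.
have AMP z M : \1_A (z + (M * P)%N%:Z) = \1_A z :> R.
  elim: M => [|M IH]; first by rewrite mul0n addr0.
  by rewrite mulSnr PoszD addrA AP.
have bnd M : `|(\sum_(k < M.*2.+1) \1_A (k%:Z - M%:Z)) / (M.*2.+1)%:R - d|
    <= P%:R * (M.+1%:R)^-1 :> R.
  have M0 : 0 < (M.*2.+1)%:R :> R by rewrite ltr0n.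
  (* Translation by [M P], a multiple of the period, moves the window [[-M, M]] into the natural
     numbers. *)
  have -> : \sum_(k < M.*2.+1) \1_A (k%:Z - M%:Z)
      = \sum_(k < M.*2.+1) \1_A ((M * P.-1 + k)%N%:Z) :> R.
    apply: eq_bigr => k _; rewrite -(AMP _ M); congr (\1_A _).
    by rewrite -{1}(prednK P0) mulnS; lia.
  have h := @sum_periodic_approx R (fun n => \1_A n%:Z) P (M * P.-1) M.*2.+1 P0.
  set S := \sum_(k < M.*2.+1) _ in h *.
  have -> : S / (M.*2.+1)%:R - d = (S - (M.*2.+1)%:R * d) / (M.*2.+1)%:R.
    by rewrite mulrBl mulrAC divff ?mul1r // gt_eqF.
  rewrite normrM normfV (gtr0_norm M0); apply: ler_pM => //.
    apply: h => k; first by rewrite PoszD AP.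
    by rewrite indicE; case: (_ \in _); rewrite lexx ler01.
  by rewrite lef_pV2 ?posrE ?ltr0n // ler_nat; lia.
have cvP : (fun M => P%:R * harmonic M : R) @ \oo --> P%:R * (0 : R).
  by apply: cvgM; [exact: cvg_cst|exact: cvg_harmonic].
apply: (@squeeze_cvgr _ _ _ _ (fun M => d - P%:R * harmonic M) (fun M => d + P%:R * harmonic M)).
- by apply: nearW => M; rewrite -ler_distl; exact: bnd.
- rewrite -[X in _ --> X]subr0 -[X in _ - X](mulr0 P%:R).
  by apply: cvgB => //; exact: cvg_cst.
- rewrite -[X in _ --> X]addr0 -[X in _ + X](mulr0 P%:R).
  by apply: cvgD => //; exact: cvg_cst.
Qed.

(** Adding [n] keeps the class and makes the representative positive, as [residue_system]
    demands. *)
Definition residue_fset (N B : nat) (r : nat -> nat) : {fset nat * nat} :=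
  [fset (n, (r n %% n + n)%N) | n in index_iota N.+1 B.+1]%fset.

Lemma residue_fsetP (N B : nat) (r : nat -> nat) (p : nat * nat) :
  reflect (exists2 n, (N < n <= B)%N & p = (n, r n %% n + n)%N)
          (p \in residue_fset N B r).
Proof.
apply: (iffP (imfsetP _ _ _ _)) => -[n /=].
  by rewrite mem_index_iota ltnS => nB ->; exists n.
by move=> nB ->; exists n => //=; rewrite mem_index_iota ltnS.
Qed.

Lemma uncovered_residue_fset (N B : nat) (r : nat -> nat) (z : int) :
  uncovered (residue_fset N B r) z
    <-> forall n, (N < n <= B)%N -> (z <> (r n)%:Z %[mod n%:Z])%Z.
Proof.
have rn n : (((r n %% n + n)%N%:Z) %% n%:Z = (r n)%:Z %% n%:Z)%Z.
  by rewrite !modz_nat modnDr modn_mod.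
split=> [zC n nB|zC p /residue_fsetP[n nB ->]].
  by rewrite -rn; apply: (zC (n, r n %% n + n)%N); apply/residue_fsetP; exists n.
by rewrite /= rn; exact: zC.
Qed.

(** [B!] is a common multiple of the moduli, hence a period of the uncovered set. *)
Lemma has_density_residue_fset (R : realType) (N B : nat) (r : nat -> nat) :
  has_density (uncovered (residue_fset N B r))
    ((\sum_(x < B`!) avoids N B r x)%N%:R / B`!%:R : R).
Proof.
have -> : (\sum_(x < B`!) avoids N B r x)%N%:R
    = \sum_(x < B`!) \1_(uncovered (residue_fset N B r)) x%:Z :> R.
  rewrite natr_sum; apply: eq_bigr => x _; rewrite indicE; congr (_%:R).
  congr nat_of_bool; apply/idP/idP.
    move=> /allP xa; rewrite inE; apply/uncovered_residue_fset => n nB.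
    rewrite !modz_nat => -[/eqP]; apply/negP; apply: xa.
    by rewrite mem_index_iota ltnS.
  rewrite inE => /uncovered_residue_fset xa; apply/allP => n.
  rewrite mem_index_iota ltnS => nB; apply/eqP => h; apply: (xa n nB).
  by rewrite !modz_nat h.
apply: has_density_periodic => [|z]; first exact: fact_gt0.
rewrite !indicE; congr (_%:R); congr nat_of_bool.
have zB n : (N < n <= B)%N -> ((z + B`!%:Z) %% n%:Z = z %% n%:Z)%Z.
  move=> nB; have /dvdnP[q ->] : (n %| B`!)%N by apply: dvdn_fact; lia.
  by rewrite PoszM addrC modzMDl.
by apply/idP/idP; rewrite !inE => /uncovered_residue_fset zC;
  apply/uncovered_residue_fset => n nB; have := zC n nB; rewrite zB.
Qed.

Theorem theorem6 (R : realType) :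
  exists K0 : R, forall N K : nat, (1 <= N)%N -> K0 <= K%:R ->
    exists C : {fset nat * nat},
      [/\ residue_system C,
          distinct_moduli C,
          (forall p, p \in C -> (N < p.1 <= K * N)%N) &
          exists2 d : R, has_density (uncovered C) d &
            d <= 1 / K%:R * expR (- (ln K%:R / (3 * N%:R)))].
Proof.
(* Chosen so that the surplus [ln K / 200] from [base_gain] absorbs the error [8 ln 5 + 4]; [K0]
   below ensures both [K >= 5] and [ln K >= c]. *)
pose c : R := 200 * (8 * ln 5 + 4).
exists (5 + expR c) => N K N0 K0.
have K5 : (5 <= K)%N.
  by rewrite -(ler_nat R); apply: le_trans K0; rewrite lerDl expR_ge0.
have cK : c <= ln K%:R.
  rewrite -[leLHS]expRK ler_ln ?posrE ?expR_gt0 ?ltr0n //; last by lia.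
  by apply: le_trans K0; rewrite lerDr.
have NR : 0 < N%:R :> R by rewrite ltr0n.
have [E /andP[NE E5]] := base_gain R N0.
pose M := index_iota N.+1 E.+1; rewrite -/M /= => base.
have Ms : sorted ltn M := iota_ltn_sorted _ _.
have MN : {in M, forall m, N < m <= 5 * N}%N.
  by move=> m; rewrite mem_index_iota; lia.
have [r hr] := greedy_residues R (K * N)`! N0 (leq_pmull N (ltnW (ltnW (ltnW (ltnW K5))))) Ms MN.
have := covered_part_gain R N0 K5 Ms MN.
set S1 := \sum_(m <- M) _ in base *; set S2 := pair_sum _ _ in base * => gain.
(* [M] has at most [4 N] elements, each contributing at most [1 / N^2]. *)
have S1le : N%:R * S1 <= 4.
  apply: (@le_trans _ _ (N%:R * \sum_(m <- M) (N%:R ^+ 2)^-1)).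
    rewrite (ler_wpM2l (ltW NR)) // /S1 !big_seq; apply: ler_sum => m /MN /andP[Nm _].
    rewrite lef_pV2 ?posrE ?exprn_gt0 ?ltr0n //; last lia.
    by rewrite lerXn2r ?nnegrE // ler_nat ltnW.
  rewrite sumr_const_nat -[X in _ * X]mulr_natr mulrA expr2 invfM mulrA divff ?gt_eqF // mul1r.
  by rewrite ler_pdivrMl // -natrM ler_nat; lia.
have ln5 : 0 <= ln 5 :> R by rewrite ln_ge0 // ler1n.
exists (residue_fset N (K * N) r); split.
- by move=> p /residue_fsetP[n nB ->] /=; lia.
- by move=> p q /residue_fsetP[n _ ->] /residue_fsetP[m _ ->] /= ->.
- by move=> p /residue_fsetP[n nB ->].
exists ((\sum_(x < (K * N)`!) avoids N (K * N) r x)%N%:R / ((K * N)`!)%:R).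
  exact: has_density_residue_fset.
rewrite ler_pdivrMr ?ltr0n ?fact_gt0 // [leRHS]mulrC mulrA.
apply: (le_trans hr).
rewrite prod_one_sub_inv //; last by rewrite leq_pmull //; lia.
have -> : N%:R / (K * N)%:R = 1 / K%:R :> R.
  by rewrite natrM; field; rewrite !gt_eqF ?ltr0n //; lia.
rewrite ler_wpM2l ?mulr_ge0 ?divr_ge0 // ler_expR lerN2.
have -> : \sum_(N.+1 <= n < (K * N).+1 | (5 * N < n)%N) covered_part R M n / n%:R
    = \sum_((5 * N).+1 <= n < (K * N).+1) covered_part R M n / n%:R.
  by rewrite [RHS](@big_nat_widenl _ _ _ _ N.+1) //; lia.
apply: le_trans gain.
rewrite ler_pdivrMr ?mulr_gt0 //.
have S20 : 0 <= S2 by apply: pair_sum_ge0 => x y; rewrite invr_ge0 sqr_ge0.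
rewrite mulrBr in base.
have -> : (S1 * (ln K%:R - 2 * ln 5) - S2 * (ln K%:R + 1)) * (3 * N%:R)
    = 3 * ((N%:R * S1 - N%:R * S2) * ln K%:R - 2 * (N%:R * S1 * ln 5) - N%:R * S2).
  by ring.
have S2le : N%:R * S2 <= 4 by lra.
have l0 : 0 <= ln K%:R :> R by apply: le_trans cK; rewrite mulr_ge0 // addr_ge0 // mulr_ge0.
have h1 := ler_wpM2r l0 base.
have h2 := ler_wpM2r ln5 S1le.
(* The errors [2 N S1 ln 5] and [N S2] are at most [8 ln 5] and 4. *)
rewrite /c in cK; lra.
Qed.
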